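(* If $\mathcal{I}$ is an ideal on $\omega$ which is not tall, then $$\aleph_1\le\mathfrak{b}(\mathcal{I},\mathcal{I},\mathcal{I})\le\mathfrak{b}=\mathfrak{b}(\mathcal{I},\mathrm{Fin},\mathrm{Fin})=\mathfrak{b}(\mathcal{I},\mathcal{I},\mathrm{Fin}).$$
   Context: An ideal on $\omega$ is a family $\mathcal{I}\subseteq\mathcal{P}(\omega)$ closed under finite unions and subsets, containing all finite sets, with $\omega\notin\mathcal{I}$; $\mathrm{Fin}$ is the ideal of finite sets. $\mathcal{I}$ is tall if every infinite $A\subseteq\omega$ contains an infinite $B\in\mathcal{I}$. $\mathfrak{b}$ is the bounding number. For an ideal $\mathcal{K}$, $\widehat{\mathcal{P}}_{\mathcal{K}}$ is the family of sequences $\langle A_n\rangle$ of pairwise disjoint members of $\mathcal{K}$, and $\mathcal{P}_{\mathcal{K}}$ those with union $\omega$. $\mathfrak{b}(\mathcal{I},\mathcal{J},\mathcal{K})=\min\{|\mathcal{E}|:\mathcal{E}\subseteq\widehat{\mathcal{P}}_{\mathcal{K}},\ \forall\langle A_n\rangle\in\mathcal{P}_{\mathcal{J}}\ \exists\langle E_n\rangle\in\mathcal{E}\ \bigcup_n(A_n\cap\bigcup_{i\le n}E_i)\notin\mathcal{I}\}$, with $\min\emptyset=\mathfrak{c}^+$. *)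

(* Defs.v *)
From mathcomp Require Import all_boot.
From mathcomp Require Import boolp classical_sets functions cardinality.

Set Implicit Arguments.
Unset Strict Implicit.
Unset Printing Implicit Defensive.

Local Open Scope classical_set_scope.
Local Open Scope card_scope.

(* A cardinal number is an equipotence class of types; by propositional and
   functional extensionality, equality of cardinals is Leibniz equality, see
   [card_ofP]. *)
Record cardinal := Cardinal {
  cardinal_class : Type -> Prop;
  cardinal_classP : exists2 T : Type,
    cardinal_class T & cardinal_class = (fun U : Type => [set: U] #= [set: T])
}.

Definition card_type (T : Type) : cardinal :=
  @Cardinal (fun U : Type => [set: U] #= [set: T]) (ex_intro2 _ _ T (card_eqxx _) erefl).

Definition card_of (T : Type) (A : set T) : cardinal := card_type (set_type A).

Definition cardinal_le (k l : cardinal) : Prop :=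
  exists T U : Type,
    [/\ cardinal_class k T, cardinal_class l U & [set: T] #<= [set: U]].

Definition cardinal_lt (k l : cardinal) : Prop := cardinal_le k l /\ k <> l.

Declare Scope cardinal_scope.
Delimit Scope cardinal_scope with cardinal.
Bind Scope cardinal_scope with cardinal.
Notation "k <= l" := (cardinal_le k l) : cardinal_scope.
Notation "k < l" := (cardinal_lt k l) : cardinal_scope.

(* Families of cardinals are plain predicates: [set cardinal] would force the
   types forming a cardinal into a universe below that of [set].
   A nonempty family has a unique least element, see [cardinal_min_spec]. *)
Definition cardinal_least (S : cardinal -> Prop) (k : cardinal) : Prop :=
  S k /\ forall l, S l -> (k <= l)%cardinal.

(* The least element of [S], or [d] if [S] is empty. *)
Definition cardinal_min (d : cardinal) (S : cardinal -> Prop) : cardinal :=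
  match pselect (exists k, cardinal_least S k) with
  | left e => sval (cid e)
  | right _ => d
  end.

(* The default value is irrelevant, by Cantor's theorem. *)
Definition cardinal_succ (k : cardinal) : cardinal :=
  cardinal_min k (fun l => (k < l)%cardinal).

Definition aleph0 : cardinal := card_of [set: nat].
Definition aleph1 : cardinal := cardinal_succ aleph0.
Definition continuum : cardinal := card_of [set: set nat].

Record is_ideal (I : set (set nat)) : Prop := IsIdeal {
  ideal_setU : forall A B : set nat, I A -> I B -> I (A `|` B);
  ideal_subset : forall A B : set nat, A `<=` B -> I B -> I A;
  ideal_finite : forall A : set nat, finite_set A -> I A;
  ideal_proper : ~ I [set: nat]
}.

Definition Fin : set (set nat) := [set A | finite_set A].

Definition tall (I : set (set nat)) : Prop :=
  forall A : set nat, infinite_set A ->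
    exists B : set nat, [/\ B `<=` A, infinite_set B & I B].

Definition disjoint_seqs (K : set (set nat)) : set (nat -> set nat) :=
  [set A | (forall n, K (A n)) /\ trivIset [set: nat] A].

Definition partition_seqs (K : set (set nat)) : set (nat -> set nat) :=
  [set A | disjoint_seqs K A /\ \bigcup_n A n = [set: nat]].

Definition b_witness (I J K : set (set nat)) (E : set (nat -> set nat)) : Prop :=
  E `<=` disjoint_seqs K /\
  forall A, partition_seqs J A ->
    exists2 F, E F &
      ~ I (\bigcup_n (A n `&` \bigcup_(i in [set i | (i <= n)%N]) F i)).

Definition b_ideal (I J K : set (set nat)) : cardinal :=
  cardinal_min (cardinal_succ continuum)
    (fun k => exists2 E, b_witness I J K E & k = card_of E).

Definition dominated (f g : nat -> nat) : Prop :=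
  exists m : nat, forall n : nat, (m <= n)%N -> (f n <= g n)%N.

Definition unbounded (F : set (nat -> nat)) : Prop :=
  ~ exists g : nat -> nat, forall f, F f -> dominated f g.

(* The default value is irrelevant: the set of all functions is unbounded. *)
Definition bounding_number : cardinal :=
  cardinal_min (cardinal_succ continuum)
    (fun k => exists2 F, unbounded F & k = card_of F).

Lemma cardinal_inj (k l : cardinal) :
  cardinal_class k = cardinal_class l -> k = l.
Proof.
case: k l => [c p] [c' p'] /= e; subst c'.
by congr Cardinal; exact: Prop_irrelevance.
Qed.

Lemma card_of_surj (k : cardinal) : exists T : Type, k = card_of [set: T].
Proof.
case: (cardinal_classP k) => T _ e; exists T; apply: cardinal_inj; rewrite e /=.
apply/funext => U; congr is_true.
by rewrite (card_eqr (card_setT [set: T])).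
Qed.

Lemma card_ofP (T U : Type) (A : set T) (B : set U) :
  card_of A = card_of B <-> A #= B.
Proof.
split=> [e|AB].
  have : cardinal_class (card_of A) (set_type A) by rewrite /=.
  by rewrite e /= (card_eql (card_setT _)) (card_eqr (card_setT _)).
apply: cardinal_inj; apply/funext => V /=; congr is_true.
by rewrite !(card_eqr (card_setT _)) (card_eqr AB).
Qed.

Lemma card_of_leP (T U : Type) (A : set T) (B : set U) :
  (card_of A <= card_of B)%cardinal <-> A #<= B.
Proof.
split=> [[V [W [/= VA WB VW]]]|AB].
  rewrite -(card_le_eql (card_setT A)) -(card_le_eqr (card_setT B)).
  by rewrite -(card_le_eql VA) -(card_le_eqr WB).
exists (set_type A), (set_type B); split => //=.
by rewrite (card_le_eql (card_setT A)) (card_le_eqr (card_setT B)).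
Qed.

Lemma cardinal_le_refl (k : cardinal) : (k <= k)%cardinal.
Proof. by have [T ->] := card_of_surj k; apply/card_of_leP. Qed.

Lemma cardinal_le_trans (l k m : cardinal) :
  (k <= l)%cardinal -> (l <= m)%cardinal -> (k <= m)%cardinal.
Proof.
have [T ->] := card_of_surj k; have [U ->] := card_of_surj l.
have [V ->] := card_of_surj m.
by move=> /card_of_leP TU /card_of_leP UV; apply/card_of_leP/(card_le_trans TU).
Qed.

Lemma cardinal_le_anti (k l : cardinal) :
  (k <= l)%cardinal -> (l <= k)%cardinal -> k = l.
Proof.
have [T ->] := card_of_surj k; have [U ->] := card_of_surj l.
move=> /card_of_leP TU /card_of_leP UT; apply/card_ofP.
exact: Cantor_Bernstein.
Qed.

Lemma inj_card_type (T U : Type) (f : T -> U) :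
  injective f -> [set: T] #<= [set: U].
Proof.
move=> fi; rewrite -(card_le_eql (@inj_card_eq _ _ [set: T] f _)); last first.
  by move=> x y _ _ /fi.
exact: card_leT.
Qed.

(* Cardinals are well-ordered: project a maximal subset of the product of the
   family on which all coordinates are injective. *)
Lemma least_type (X : Type) (x0 : X) (T : X -> Type) :
  exists x, forall y, [set: T x] #<= [set: T y].
Proof.
pose P : set (set (forall x, T x)) :=
  [set F | forall f g x, F f -> F g -> f x = g x -> f = g].
have [|F [PF Fmax]] := @Zorn_bigcup _ P.
  move=> C CP Ctot f g x [A CA Af] [B CB Bg] fg.
  have [AB|BA] := Ctot _ _ CA CB.
    by apply: (CP _ CB f g x) => //; exact: AB.
  by apply: (CP _ CA f g x) => //; exact: BA.
have [x xsurj] : exists x, forall t : T x, exists2 f, F f & f x = t.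
  apply: contrapT => nsurj.
  have [h hP] : exists h, forall x f, F f -> f x <> h x.
    suff /all_sig [h hP] : forall x, {t : T x | forall f, F f -> f x <> t}.
      by exists h.
    move=> x; apply: cid; move: x.
    move=> x; apply: contrapT => nt; apply: nsurj; exists x => t.
    apply: contrapT => nf; apply: nt; exists t => f Ff ft.
    by apply: nf; exists f.
  apply: (Fmax (F `|` [set h])).
    split; first by left.
    by move=> /(_ h (or_intror erefl)) Fh; exact: (hP x0 h Fh erefl).
  move=> f g x [Ff|->] [Fg|->] // fg; first exact: PF fg.
    by have := hP x f Ff.
  by have := hP x g Fg; rewrite fg.
exists x => y.
have /choice [s sP] : forall t : T x, exists f, F f /\ f x = t.
  by move=> t; have [f Ff ft] := xsurj t; exists f.
apply: (@inj_card_type _ _ (fun t => s t y)) => t u stu.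
have [[Ft <-] [Fu <-]] := (sP t, sP u).
by rewrite (PF _ _ _ Ft Fu stu).
Qed.

Lemma cardinal_le_total (k l : cardinal) :
  (k <= l)%cardinal \/ (l <= k)%cardinal.
Proof.
have [T ->] := card_of_surj k; have [U ->] := card_of_surj l.
have [[] bmin] := @least_type bool true (fun b => if b then T else U).
  by left; apply/card_of_leP; exact: bmin false.
by right; apply/card_of_leP; exact: bmin true.
Qed.

Lemma cardinal_min_spec (d : cardinal) (S : cardinal -> Prop) :
  (exists k, S k) -> cardinal_least S (cardinal_min d S).
Proof.
move=> [k0 Sk0]; rewrite /cardinal_min; case: pselect => [e|nS].
  exact: (svalP (cid e)).
exfalso; apply: nS.
have [T0 k0E] := card_of_surj k0.
have S0 : S (card_of [set: T0]) by rewrite -k0E.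
pose X : Type := {A : set T0 | S (card_of A)}.
have [[A SA] Amin] := @least_type X (exist _ _ S0) (fun B => set_type (sval B)).
have {}Amin (B : set T0) : S (card_of B) -> (card_of A <= card_of B)%cardinal.
  move=> SB; apply/card_of_leP; have := Amin (exist _ B SB).
  by rewrite (card_le_eql (card_setT _)) (card_le_eqr (card_setT _)).
exists (card_of A); split=> // l Sl.
have [|lk0] := cardinal_le_total k0 l.
  by apply: cardinal_le_trans; rewrite k0E; exact: Amin.
have [U lE] := card_of_surj l; move: lk0; rewrite lE k0E => /card_of_leP.
move=> /card_leP[f].
pose h (u : U) : T0 := val (f (to_setT u)).
have hi : injective h.
  move=> u v /val_inj/'inj_f/=; rewrite !in_setT => /(_ isT isT).
  exact: (congr1 val).
have lB : card_of [set: U] = card_of (h @` [set: U]).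
  by apply/card_ofP; rewrite card_eq_sym; apply: inj_card_eq => u v _ _ /hi.
by rewrite lB; apply: Amin; rewrite -lB -lE.
Qed.

Lemma cardinal_min0 (d : cardinal) : cardinal_min d (fun=> False) = d.
Proof. by rewrite /cardinal_min; case: pselect => // -[k []]. Qed.

Lemma cardinal_succ_spec (k : cardinal) :
  cardinal_least (fun l => (k < l)%cardinal) (cardinal_succ k).
Proof.
apply: cardinal_min_spec.
have [T ->] := card_of_surj k; exists (card_of [set: set T]); split.
  apply/card_of_leP; apply: (@inj_card_type _ _ set1) => x y xy.
  by have : [set x] x by []; rewrite xy.
move=> /card_ofP; rewrite card_eq_sym.
move=> /card_bijP[f [g fK gK]].
pose s := g \o to_setT; pose D := [set t | ~ val (s t) t].
have sD : val (s (val (f (to_setT D)))) = D.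
  rewrite /s /=; have -> : to_setT (val (f (to_setT D))) = f (to_setT D).
    exact: val_inj.
  by rewrite fK.
have nD : ~ D (val (f (to_setT D))) by move=> /[dup] Dx; rewrite /D /= sD.
by apply: (nD); rewrite /D /= sD.

Qed.

(* Main.v *)
Require Import Defs.
From mathcomp Require Import all_boot.
From mathcomp Require Import boolp classical_sets functions cardinality.
From mathcomp Require Import sequences.

(** A witness for (I,I,Fin) is also one for (I,I,I) and for (I,Fin,Fin), so
    b(I,I,I) <= b(I,I,Fin) and b(I,Fin,Fin) <= b(I,I,Fin).

    For the lower bounds aleph1 <= b(I,I,I) and b <= b(I,Fin,Fin), suppose that
    a single sequence of sets G n in J eventually contains the initial unions
    of E_0, ..., E_(n+1) for every E in the family.  Sending x to the least n
    with x in G n (or x = n) is a partition A into members of J with A (n+1)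
    disjoint from G n, hence A n meets the n-th initial union of E for finitely
    many n only, and the family is no witness.  Such a G exists for a countable
    family by diagonalising, and for a family of sequences of finite sets
    whenever the bounds of their initial unions are dominated by one function.

    For b(I,I,Fin) <= b, take an infinite C none of whose infinite subsets is in
    I.  To f assign the sequence whose n-th initial union contains the elements
    of C below f n.  A partition A into members of I leaves points x_n >= n of C
    outside A_0, ..., A_n; whenever x_n < f n the point x_n is in the set
    attached to A and f, so this set is not in I as soon as f is not dominated
    by n |-> x_n. *)

Set Implicit Arguments.
Unset Strict Implicit.
Unset Printing Implicit Defensive.

Local Open Scope classical_set_scope.
Local Open Scope card_scope.

Lemma finite_set_nat_bounded (A : set nat) :
  finite_set A -> exists N, A `<=` `I_N.
Proof.
move=> /finite_seqP[s ->]; exists (\max_(i <- s) i).+1 => x /= xs.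
by rewrite ltnS; apply: leq_bigmax_seq.
Qed.

Lemma is_ideal_Fin : is_ideal Fin.
Proof.
split=> [A B finA finB|A B AB finB|A //|]; last exact: infinite_nat.
- by rewrite /Fin /= finite_setU.
- exact: sub_finite_set AB finB.
Qed.

Lemma ideal_bigcup (I : set (set nat)) (T : Type) (D : set T)
    (F : T -> set nat) :
  is_ideal I -> finite_set D -> (forall i, D i -> I (F i)) ->
  I (\bigcup_(i in D) F i).
Proof.
move=> idealI; elim/Pchoice: T => T in D F *.
move=> /finite_fsetP[X ->] IF; rewrite bigcup_fset big_seq.
elim/big_ind : _ => [|A B|i iX]; [|exact: ideal_setU|exact: IF].
exact: ideal_finite.
Qed.

Lemma disjoint_seqs_seqDU (K : set (set nat)) (G : nat -> set nat) :
  is_ideal K -> (forall n, K (G n)) -> disjoint_seqs K (seqDU G).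
Proof.
move=> idealK KG; split; last exact: trivIset_seqDU.
by move=> n; apply: ideal_subset (KG n) => // x [].
Qed.

Lemma not_b_witness (I J K : set (set nat)) (E : set (nat -> set nat))
    (G : nat -> set nat) :
  is_ideal I -> is_ideal J -> J `<=` I -> (forall n, J (G n)) ->
  (forall F, E F -> exists m, forall n, (m <= n)%N ->
    \bigcup_(i in [set i | (i <= n.+1)%N]) F i `<=` G n) ->
  ~ b_witness I J K E.
Proof.
move=> idealI idealJ JI JG EG [_ witE].
(* Adding [n] makes the sets cover [nat]. *)
pose H n := G n `|` [set n].
have disjA : disjoint_seqs J (seqDU H).
  apply: disjoint_seqs_seqDU => // n; apply: ideal_setU => //.
  exact: ideal_finite.
have partA : partition_seqs J (seqDU H).
  split=> //; rewrite -seqDU_bigcup_eq -subTset => x _.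
  by exists x => //; right.
have [F /EG[m Gm]] := witE _ partA; apply.
have : I (\bigcup_(n in `I_m.+1) seqDU H n).
  by apply: ideal_bigcup => // n _; apply: JI; apply: disjA.1.
apply: (ideal_subset idealI) => x [[|n] _ [Ax Fx]].
  by exists 0%N.
have [mn|nm] := leqP m n; last by exists n.+1.
(* The initial union up to [n.+1] lies in [G n], which [seqDU] removes from term [n.+1]. *)
case: Ax => _ nHx; exfalso; apply: nHx; rewrite -bigcup_mkord; exists n => //=.
by left; exact: Gm Fx.
Qed.

Lemma b_witness_uncountable (I : set (set nat)) (E : set (nat -> set nat)) :
  is_ideal I -> b_witness I I I E -> ~ countable E.
Proof.
move=> idealI witE /countable_injP[f finj].
(* Each [P n] is finite as [f] is injective on [E], and [F] belongs to it from [n = f F] on. *)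
pose P n := [set F | E F /\ (f F <= n)%N].
pose U (F : nat -> set nat) n := \bigcup_(i in [set i | (i <= n)%N]) F i.
pose G n := \bigcup_(F in P n) U F n.+1.
have leq_finite n : finite_set [set i | (i <= n)%N].
  exact: (finite_II n.+1).
apply: (@not_b_witness I I I E G _ _ _ _ _ witE) => // [n|F EF].
  have finP : finite_set (P n).
    rewrite -(eq_finite_set (@inj_card_eq _ _ _ f _)).
      by apply: sub_finite_set (finite_II n.+1) => _ [F [_ fF] <-].
    by move=> F F' /set_mem[EF _] /set_mem[EF' _]; apply: finj; rewrite inE.
  apply: ideal_bigcup => // F [EF _]; apply: ideal_bigcup => // i _.
  exact: (witE.1 _ EF).1.
by exists (f F) => n fn x Ux; exists F.
Qed.

Lemma b_witness_unbounded (I : set (set nat)) (E : set (nat -> set nat)) :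
  is_ideal I -> b_witness I Fin Fin E ->
  exists2 F, unbounded F & F #<= E.
Proof.
move=> idealI witE.
have /choice[b bP] : forall F, exists b : nat -> nat, E F ->
    forall n, \bigcup_(i in [set i | (i <= n)%N]) F i `<=` `I_(b n).
  move=> F; have [EF|//] := pselect (E F); last by exists id.
  have /choice[b bP] : forall n, exists b,
      \bigcup_(i in [set i | (i <= n)%N]) F i `<=` `I_b.
    move=> n; apply: finite_set_nat_bounded; apply: bigcup_finite.
      exact: (finite_II n.+1).
    by move=> i _; exact: (witE.1 _ EF).1.
  by exists b.
exists (b @` E); last exact: card_image_le.
move=> [g gP]; move: witE.
apply: (@not_b_witness I Fin Fin E (fun n => `I_(g n.+1))) => //.
- exact: is_ideal_Fin.
- by move=> A; apply: ideal_finite.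
- by move=> n; apply: finite_II.
move=> F EF; have [|m mP] := gP (b F); first by exists F.
exists m => n mn x /(bP _ EF) /= /leq_trans; apply.
by apply: mP; apply: leq_trans mn _.
Qed.

Lemma unbounded_b_witness (I : set (set nat)) (F : set (nat -> nat)) :
  is_ideal I -> ~ tall I -> unbounded F ->
  exists2 E, b_witness I I Fin E & E #<= F.
Proof.
move=> idealI /existsNP[C] /not_implyP[infC noB] unbF.
have finI B : B `<=` C -> I B -> finite_set B.
  by move=> BC IB; apply: contrapT => infB; apply: noB; exists B.
(* [seqDU] makes the terms disjoint and keeps the initial unions. *)
pose e (f : nat -> nat) := seqDU (fun n => C `&` `I_(f n)).
exists (e @` F); last exact: card_image_le.
split=> [_ [f _ <-]|A [[IA trivA] covA]].
  apply: disjoint_seqs_seqDU; first exact: is_ideal_Fin.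
  by move=> n; apply: sub_finite_set (finite_II (f n)) => x [].
have /choice[h hP] : forall n, exists x,
    [/\ C x, (n <= x)%N & forall i, (i <= n)%N -> ~ A i x].
  (* Otherwise [C] is covered by [n] points and its traces on [A 0], ..., [A n], which are finite as
     these sets lie in [I]. *)
  move=> n; apply: contrapT => nox; apply: infC.
  apply: (@sub_finite_set _ _
    (`I_n `|` \bigcup_(i in `I_n.+1) (C `&` A i))) => [x Cx|].
    have [nx|xn] := leqP n x; last by left.
    right; apply: contrapT => nAx; apply: nox; exists x; split=> // i ni Aix.
    by apply: nAx; exists i.
  rewrite finite_setU; split; first exact: finite_II.
  apply: bigcup_finite => [|i _]; first exact: finite_II.
  apply: finI; first exact: subIsetl.
  by apply: (ideal_subset idealI) (IA i); exact: subIsetr.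
have [f Ff fh] : exists2 f, F f & ~ dominated f h.
  apply: contrapT => domF; apply: unbF; exists h => f Ff.
  by apply: contrapT => fh; apply: domF; exists f.
exists (e f); first by exists f.
set W := (X in ~ I X) => IW.
have /finite_set_nat_bounded[N WN] : finite_set (C `&` W).
  apply: finI; first exact: subIsetl.
  by apply: (ideal_subset idealI) IW; exact: subIsetr.
apply: fh; exists N => n Nn; rewrite leqNgt; apply/negP => hf.
have [Chn nhn Ahn] := hP n.
suff /WN : (C `&` W) (h n) by rewrite /= ltnNge (leq_trans Nn nhn).
split=> //; have : [set: nat] (h n) by [].
rewrite -covA => -[k _ Akh]; exists k => //; split=> //.
(* Since [h n] avoids [A 0], ..., [A n], the [k]-th initial union contains the [n]-th. *)
have nk : (n < k)%N by rewrite ltnNge; apply/negP => /Ahn.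
have : (\bigcup_(i in `I_n.+1) e f i) (h n).
  have -> : \bigcup_(i in `I_n.+1) e f i =
            \bigcup_(i in `I_n.+1) (C `&` `I_(f i)).
    by rewrite !bigcup_mkord -bigsetU_seqDU.
  by exists n => //=.
by move=> [i ni eih]; exists i => //=; apply: leq_trans (ltnW nk).
Qed.

(** The least element of [S'] bounds some element of [S], so neither minimum is a default value. *)
Lemma cardinal_min_le (d d' : cardinal) (S S' : cardinal -> Prop) :
  (exists k, S' k) -> (forall k, S' k -> exists2 l, S l & (l <= k)%cardinal) ->
  (cardinal_min d S <= cardinal_min d' S')%cardinal.
Proof.
move=> exS' S'S; have [S'm _] := cardinal_min_spec d' exS'.
have [l Sl lm] := S'S _ S'm; apply: cardinal_le_trans lm.
by have [_] := @cardinal_min_spec d S (ex_intro _ l Sl); apply.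
Qed.

Lemma unbounded_setT : unbounded [set: nat -> nat].
Proof.
move=> [g /(_ (fun n => (g n).+1) Logic.I)[m /(_ m (leqnn m))]].
by rewrite ltnn.
Qed.

Lemma b_witness_mono (I J J' K K' : set (set nat)) (E : set (nat -> set nat)) :
  J' `<=` J -> K `<=` K' -> b_witness I J K E -> b_witness I J' K' E.
Proof.
move=> J'J KK' [EK witE]; split=> [F /EK[KF trivF]|A [[JA trivA] covA]].
  by split=> // n; apply: KK'.
by apply: witE; split=> //; split=> // n; apply: J'J.
Qed.

Lemma aleph1_le (T : Type) (A : set T) :
  ~ countable A -> (aleph1 <= card_of A)%cardinal.
Proof.
move=> ncA; have [_] := cardinal_succ_spec aleph0; apply; split.
  have [//|/card_of_leP cA] := cardinal_le_total aleph0 (card_of A).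
  by exfalso; apply: ncA.
move=> /card_ofP eqA; apply: ncA; rewrite /countable.
by move: eqA; rewrite card_eq_sym card_eq_le => /andP[].
Qed.

Theorem theorem5p2 (I : set (set nat)) (idealI : is_ideal I)
    (not_tallI : ~ tall I) :
  [/\ (aleph1 <= b_ideal I I I)%cardinal,
      (b_ideal I I I <= bounding_number)%cardinal,
      bounding_number = b_ideal I Fin Fin &
      b_ideal I Fin Fin = b_ideal I I Fin].
Proof.
have FinI : Fin `<=` I by move=> A; apply: ideal_finite.
(* The family of all functions yields a witness, so every minimum below is attained. *)
have [E0 wit0 _] := unbounded_b_witness idealI not_tallI unbounded_setT.
have III_IIF : (b_ideal I I I <= b_ideal I I Fin)%cardinal.
  apply: cardinal_min_le; first by exists (card_of E0), E0.
  move=> _ [E witE ->]; exists (card_of E); last exact: cardinal_le_refl.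
  by exists E => //; apply: b_witness_mono witE.
have IFF_IIF : (b_ideal I Fin Fin <= b_ideal I I Fin)%cardinal.
  apply: cardinal_min_le; first by exists (card_of E0), E0.
  move=> _ [E witE ->]; exists (card_of E); last exact: cardinal_le_refl.
  by exists E => //; apply: b_witness_mono witE.
have IIF_b : (b_ideal I I Fin <= bounding_number)%cardinal.
  apply: cardinal_min_le.
    by exists (card_of [set: nat -> nat]), setT => //; exact: unbounded_setT.
  move=> _ [F unbF ->].
  have [E witE EF] := unbounded_b_witness idealI not_tallI unbF.
  by exists (card_of E); [exists E|exact/card_of_leP].
have b_IFF : (bounding_number <= b_ideal I Fin Fin)%cardinal.
  apply: cardinal_min_le.
    by exists (card_of E0), E0 => //; apply: b_witness_mono wit0.
  move=> _ [E witE ->]; have [F unbF FE] := b_witness_unbounded idealI witE.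
  by exists (card_of F); [exists F|exact/card_of_leP].
split.
- have [|[E witE bE] _] := @cardinal_min_spec (cardinal_succ continuum)
    (fun k => exists2 E, b_witness I I I E & k = card_of E).
    by exists (card_of E0), E0 => //; apply: b_witness_mono wit0.
  rewrite /b_ideal bE; apply: aleph1_le.
  exact: b_witness_uncountable witE.
- exact: cardinal_le_trans IIF_b.
(* [b_IFF], [IFF_IIF] and [IIF_b] form a cycle, which gives both equalities. *)
- by apply: cardinal_le_anti => //; apply: cardinal_le_trans IIF_b.
- by apply: cardinal_le_anti => //; apply: cardinal_le_trans b_IFF.
Qed.
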